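(* Let $(Y,\le_Y)$ be a nonempty partially ordered set. The following are equivalent. (i) $(Y,\le_Y)$ is a quasilattice. (ii) For every finite poset $(X,\le_X)$ and every $A\subseteq X$, every isotone map $f\colon A\to Y$ extends to an isotone map $X\to Y$. (iii) For every poset $(X,\le_X)$ and every finite $A\subseteq X$, every isotone map $f\colon A\to Y$ extends to an isotone map $X\to Y$. (iv) For every finite subset $A$ of the poset $(FC,\subseteq)$, every isotone map $f\colon A\to Y$ extends to an isotone map $FC\to Y$.
   Context: A map is isotone if $x\le y$ implies $f(x)\le f(y)$; subsets carry the induced order; an extension of $f\colon A\to Y$ to $X\supseteq A$ is a map agreeing with $f$ on $A$. A poset $(Y,\le_Y)$ is a quasilattice if for all finite $A,B\subseteq Y$ such that $a\le_Y b$ for all $a\in A$, $b\in B$, there exists $y^*\in Y$ with $a\le_Y y^*\le_Y b$ for all $a\in A$, $b\in B$. $FC$ denotes the set of all finite subsets of a countably infinite set, ordered by inclusion. *)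

(* Defs.v *)
From HB Require Import structures.
From mathcomp Require Import all_boot all_order.
From mathcomp Require Import boolp classical_sets functions cardinality.

Set Implicit Arguments.
Unset Strict Implicit.
Unset Printing Implicit Defensive.

Local Open Scope order_scope.
Local Open Scope classical_set_scope.

(* A subset [A : set X] coerces to [set_type A], which unfolds to a [sig] type;
   this instance therefore gives every subset of a poset its induced order. *)
HB.instance Definition _ (d : Order.disp_t) (X : porderType d) (P : pred X) :=
  [SubChoice_isSubPOrder of {x : X | P x} by <: with d].

(* The two bounds on [y] are quantified separately so that they keep their
   content when [A] or [B] is empty. *)
Definition quasilattice (d : Order.disp_t) (Y : porderType d) : Prop :=
  forall A B : set Y, finite_set A -> finite_set B ->
    (forall a b, A a -> B b -> a <= b) ->
    exists y : Y, (forall a, A a -> a <= y) /\ (forall b, B b -> y <= b).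

Definition isotone_extensions (dX dY : Order.disp_t) (X : porderType dX)
    (A : set X) (Y : porderType dY) : Prop :=
  forall f : A -> Y, Order.nondecreasing f ->
    exists g : X -> Y, Order.nondecreasing g /\ forall a : A, g (val a) = f a.

(* [set nat] is ordered by inclusion in the library, so the poset [FC] is the
   subset below with its induced order. *)
Definition FC : set (set nat) := [set S | finite_set S].

(* Main.v *)
Require Import Defs.
From mathcomp Require Import all_boot all_order.
From mathcomp Require Import boolp classical_sets functions cardinality.

Set Implicit Arguments.
Unset Strict Implicit.
Unset Printing Implicit Defensive.

Import Order.TTheory Order.DefaultSetSubsetOrder.

Local Open Scope order_scope.
Local Open Scope classical_set_scope.

(** An isotone map on part of a finite poset extends one point at a time: the value at a new point
    must lie above the values below it and under the values above it, and a quasilattice supplies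
    such a value ([quasilattice_extend1]). For finite [A] in an arbitrary poset, the extension
    problem is pulled back from the finite power set of [A]. Conversely, any two finite sets to be
    separated in [Y] can be encoded in [FC] with a point between their codes; its image under an
    extension separates them. *)

(** Lets the partial map be given by a family of points and values instead of a function on a
    subtype; the hypothesis on [p] and [q] provides both well-definedness and monotonicity. *)
Lemma isotone_extensions_range (dX dY : Order.disp_t) (X : porderType dX)
    (Y : porderType dY) (I : Type) (p : I -> X) (q : I -> Y) :
    isotone_extensions (range p) Y ->
    (forall i j, p i <= p j -> q i <= q j) ->
  exists g : X -> Y, Order.nondecreasing g /\ forall i, g (p i) = q i.
Proof.
move=> ext pq.
have preim (e : range p) : exists i, p i = val e.
  by case: e => x /= xp; have /set_mem[i _ <-] := xp; exists i.
have [r pr] := choice preim.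
have [|g [g_mono gE]] := ext (q \o r).
  by move=> e e' le_ee'; apply: pq; rewrite !pr.
exists g; split=> // i.
have pi : p i \in range p by apply/mem_set; exists i.
rewrite (gE (exist _ (p i) pi)) /=.
(* [r] may return an index other than [i] with the same point; antisymmetry in [Y] makes the two
   values equal. *)
by apply/eqP; rewrite eq_le !pq // pr.
Qed.

(** The values of [f] on points of [D] below [x0] and above [x0] form two finite sets, compared by
    transitivity through [x0]. The partial map is encoded as a total [f] whose values outside [D]
    are unconstrained. *)
Lemma quasilattice_extend1 (d dY : Order.disp_t) (X : finPOrderType d)
    (Y : porderType dY) (D : set X) (f : X -> Y) (x0 : X) :
    quasilattice Y ->
    (forall x y, D x -> D y -> x <= y -> f x <= f y) ->
  exists g : X -> Y, (forall x, D x -> g x = f x) /\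
    forall x y, (x0 |` D) x -> (x0 |` D) y -> x <= y -> g x <= g y.
Proof.
move=> qY f_mono.
have [Dx0|nDx0] := pselect (D x0).
  by exists f; split=> // x y [->|Dx] [->|Dy]; apply: f_mono.
have [||_ _ [x [Dx lx] <-] [y [Dy ly] <-]|y [yL yU]] :=
  qY (f @` [set x | D x /\ x <= x0]) (f @` [set x | D x /\ x0 <= x]).
- exact/finite_image/finite_finset.
- exact/finite_image/finite_finset.
- by apply: f_mono => //; apply: le_trans ly.
exists (fun x => if x == x0 then y else f x); split.
  by move=> x Dx; case: eqP => // xx0; case: nDx0; rewrite -xx0.
have neq x : D x -> (x == x0) = false.
  by move=> Dx; apply/eqP => xx0; case: nDx0; rewrite -xx0.
move=> x z [->|Dx] [->|Dz] le_xz; rewrite ?eqxx ?neq //.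
- by apply: yU; exists z.
- by apply: yL; exists x.
- exact: f_mono.
Qed.

Lemma quasilattice_extend (d dY : Order.disp_t) (X : finPOrderType d)
    (Y : porderType dY) (D : set X) (f : X -> Y) (s : seq X) :
    quasilattice Y ->
    (forall x y, D x -> D y -> x <= y -> f x <= f y) ->
  exists g : X -> Y, (forall x, D x -> g x = f x) /\
    forall x y, (D `|` [set` s]) x -> (D `|` [set` s]) y ->
      x <= y -> g x <= g y.
Proof.
move=> qY f_mono; elim: s => [|x0 s [g [gf g_mono]]].
  by exists f; split=> // x y [Dx|//] [Dy|//]; apply: f_mono.
have [h [hg h_mono]] := quasilattice_extend1 x0 qY g_mono.
exists h; split=> [x Dx|]; first by rewrite hg ?gf //; left.
have sub x : (D `|` [set` x0 :: s]) x -> (x0 |` (D `|` [set` s])) x.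
  case=> [Dx|/=]; first by right; left.
  by rewrite inE => /predU1P[]; [left|right; right].
by move=> x y /sub Dx /sub Dy; apply: h_mono.
Qed.

Lemma quasilattice_isotone_extensions (d dY : Order.disp_t)
    (X : finPOrderType d) (A : set X) (Y : porderType dY) :
  inhabited Y -> quasilattice Y -> isotone_extensions A Y.
Proof.
move=> [y0] qY f f_mono.
(* [y0] only fills in values outside [A], which the extension is free to replace. *)
pose f0 x := oapp f y0 (insub x).
have f0E (a : A) : f0 (val a) = f a by rewrite /f0 valK.
have f0_mono x y : A x -> A y -> x <= y -> f0 x <= f0 y.
  move=> /mem_set Ax /mem_set Ay le_xy.
  rewrite (f0E (exist _ x Ax)) (f0E (exist _ y Ay)).
  exact: f_mono.
have [g [gf g_mono]] := quasilattice_extend (enum X) qY f0_mono.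
exists g; split=> [x y|a]; last by rewrite gf ?f0E //; apply/set_mem/(valP a).
by apply: g_mono; right; rewrite /= mem_enum.
Qed.

(* [x |-> {a in A | a <= x}] maps [X] to the finite poset of subsets of [A],
   and it embeds [A]. *)
Lemma finite_isotone_extensions (d dY : Order.disp_t) (X : porderType d)
    (A : set X) (Y : porderType dY) :
    (forall (d' : Order.disp_t) (P : finPOrderType d') (B : set P),
       isotone_extensions B Y) ->
  finite_set A -> isotone_extensions A Y.
Proof.
move=> ext /finite_seqP[s sA] f f_mono.
pose down x : {set seq_sub s} := finset (fun a : seq_sub s => val a <= x).
have down_mono x y : x <= y -> down x <= down y.
  move=> le_xy; rewrite Order.SetSubsetOrder.leEsubset.
  by apply/fintype.subsetP => a; rewrite !inE => /le_trans; apply.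
have [a b|g [g_mono gf]] :=
    @isotone_extensions_range _ _ _ Y A (down \o val) f (ext _ _ _).
  rewrite /= Order.SetSubsetOrder.leEsubset => /fintype.subsetP le_ab.
  apply: f_mono.
  (* [a] belongs to its own [down] set, hence to that of [b], which means [a <= b]. *)
  have sa : val a \in s.
    by have /set_mem := valP a; move: (val a); rewrite sA.
  by have := le_ab (SeqSub sa); rewrite !inE /= lexx; apply.
exists (g \o down); split=> [x y le_xy|a]; last exact: gf.
exact/g_mono/down_mono.
Qed.

(* To separate finite [A <= B] in [Y], send the singletons [{i}], [i < n], to
   the elements of [A] and the sets [{0, ..., n - 1, n + j}] to those of [B]:
   the only strict inclusions go from the former to the latter, and
   [{0, ..., n - 1}] lies in between. *)
Lemma FC_isotone_extensions_quasilattice (dY : Order.disp_t)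
    (Y : porderType dY) :
    (forall A : set FC, finite_set A -> isotone_extensions A Y) ->
  quasilattice Y.
Proof.
move=> ext _ _ /finite_seqP[s ->] /finite_seqP[t ->] le_st.
set n := size s.
pose S (i : 'I_n + 'I_(size t)) : set nat :=
  match i with inl i => [set val i] | inr j => `I_n `|` [set (n + j)%N] end.
have S_fin i : finite_set (S i).
  case: i => i /=; first exact: finite_set1.
  by rewrite finite_setU; split; [exact: finite_II|exact: finite_set1].
pose p i : FC := exist _ (S i) (mem_set (S_fin i)).
pose q i := match i with
  | inl i => tnth (in_tuple s) i | inr j => tnth (in_tuple t) j end.
have [||g [g_mono gq]] := @isotone_extensions_range _ _ _ Y _ p q.
- exact/ext/finite_image/finite_finset.
- move=> i j; rewrite leEsub /= subsetEset.
  case: i j => [i|i] [j|j] /= Sij.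
  + by have /= /val_inj-> := Sij _ erefl.
  + by apply: le_st; exact: mem_tnth.
  (* The element [n + i] is too large for a singleton [{j}] with [j < n] and for the initial
     segment, so it can only match an [n + j] with [j = i]. *)
  + have /= nij := Sij (n + i)%N (or_intror erefl).
    by have := ltn_ord j; rewrite -nij ltnNge leq_addr.
  + have [/=|/= /addnI/val_inj->//] := Sij (n + i)%N (or_intror erefl).
    by rewrite ltnNge leq_addr.
pose m : FC := exist _ `I_n (mem_set (finite_II n)).
exists (g m); split=> [a|b] /=.
- move=> /(tnthP (in_tuple s))[i ->]; rewrite -[leLHS](gq (inl i)).
  by apply: g_mono; rewrite leEsub /= subsetEset => _ ->; exact: ltn_ord.
- move=> /(tnthP (in_tuple t))[j ->]; rewrite -[leRHS](gq (inr j)).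
  by apply: g_mono; rewrite leEsub /= subsetEset => k ?; left.
Qed.

Theorem theorem4p11 (dY : Order.disp_t) (Y : porderType dY)
    (Y_nonempty : inhabited Y) :
  [<-> quasilattice Y;
       forall (dX : Order.disp_t) (X : finPOrderType dX) (A : set X),
         isotone_extensions A Y;
       forall (dX : Order.disp_t) (X : porderType dX) (A : set X),
         finite_set A -> isotone_extensions A Y;
       forall A : set FC, finite_set A -> isotone_extensions A Y].
Proof.
tfae.
- by move=> qY dX X A; exact: quasilattice_isotone_extensions.
- by move=> ext dX X A; exact: finite_isotone_extensions.
- by move=> ext A; exact: ext.
- exact: FC_isotone_extensions_quasilattice.
Qed.
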